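(* Consider the $N$-player oligopoly with costs $J_i(x)=-s_i(x)(x_i-m_i)$ and the deception structure described in the context. Let $\delta=[\delta_{z_1},\dots,\delta_{z_n}]^\top\in\mathbb{R}^n$ satisfy $0<|\delta|<2$ and be such that $\overline{\mathcal{Q}}(\delta)$ is invertible, and let $\{\tilde J_i\}_{i\in[N]}$ be a corresponding deceptive game. Then the point $u^*=-\overline{\mathcal{Q}}(\delta)^{-1}\overline{\mathcal{B}}(\delta)$ is a Nash equilibrium of the deceptive game $\{\tilde J_i\}_{i\in[N]}$, i.e. $u_i^*=\arg\min_{x_i\in\mathbb{R}}\tilde J_i(x_i,u_{-i}^* )$ for all $i\in[N]$.
   Context: **Oligopoly.** Let $N\ge 2$, $[N]=\{1,\dots,N\}$, $R_1,\dots,R_N>0$, and define $R_{\|},\overline{R}_i$ by $\frac{1}{R_{\|}}=\sum_{k=1}^N\frac1{R_k}$, $\frac1{\overline{R}_i}=\sum_{k\neq i}\frac1{R_k}$. Let $S_d$, $m_1,\dots,m_N$ be real constants. The sales function is $s_i(x)=\frac{R_{\|}}{R_i}\big(S_d-\frac{x_i}{\overline{R}_i}+\sum_{j\neq i}\frac{x_j}{R_j}\big)$, $x\in\mathbb{R}^N$. The cost $J_i(x)=-s_i(x)(x_i-m_i)$ can be written $J_i(x)=\frac12x^\top Q_ix+b_i^\top x+\frac{R_{\|}S_dm_i}{R_i}$, where $Q_i\in\mathbb{R}^{N\times N}$ has $[Q_i]_{ii}=\frac{2R_{\|}}{R_i\overline{R}_i}$, $[Q_i]_{jk}=-\frac{R_{\|}}{R_jR_k}$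 if $j\ne k$ and ($j=i$ or $k=i$), and $0$ otherwise; and $b_i\in\mathbb{R}^N$ has $[b_i]_i=-\frac{m_iR_{\|}}{R_i\overline{R}_i}-\frac{S_dR_{\|}}{R_i}$ and $[b_i]_k=\frac{m_iR_{\|}}{R_iR_k}$ for $k\ne i$. Let $[\mathcal{Q}]_{i:}=[Q_i]_{i:}$ and $[\mathcal{B}]_i=[b_i]_i$, where $[E]_{i:}$ denotes row $i$ of $E$. For a vector $x$, $x_{-i}\in\mathbb{R}^{N-1}$ denotes all entries except $x_i$, and functions of $x$ are also written as functions of $(x_i,x_{-i})$. **Deception structure.** $\{z_1,\dots,z_n\}\subset[N]$ is the set of $n$ (distinct) deceptive players; each deceptive player $i$ deceives a nonempty set $\mathcal{D}_i\subset[N]\setminus\{i\}$. For $j\in[N]$, $\mathcal{K}_j$ is the set of deceptive players $i$ with $j\in\mathcal{D}_i$. For $\delta=[\delta_{z_1},\dots,\delta_{z_n}]^\top\in\mathbb{R}^n$ define $[\overline{\mathcal{Q}}(\delta)]_{i:}=[\mathcal{Q}]_{i:}+\sum_{k\in\mathcal{K}_i}\delta_k[Q_i]_{k:}$ and $[\overline{\mathcal{B}}(\delta)]_i=[\mathcal{B}]_i+\sum_{k\in\mathcal{K}_i}\delta_k\frac{m_iR_{\|}}{R_iR_k}$. $|\cdot|$ is the Euclidean norm. **Deceptive game.** A deceptive game corresponding to $\delta$ is a family of costs $\{\tilde J_i\}_{i\in[N]}$, $\tilde J_i:\mathbb{R}^N\to\mathbb{R}$, such that for each $i$ with $\mathcal{K}_i\ne\emptyset$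 there is a function $\sigma_i:\mathbb{R}^{N-1}\to\mathbb{R}$ with $$\tilde J_i(x)=J_i(x)+\sigma_i(x_{-i})+\sum_{k\in\mathcal{K}_i}\delta_k\int_0^{x_i}\nabla_kJ_i(y,x_{-i})\,dy\quad\text{for all }x\in\mathbb{R}^N,$$ and $\tilde J_i=J_i$ for each $i$ with $\mathcal{K}_i=\emptyset$. Here $\nabla_kJ_i$ is the partial derivative of $J_i$ with respect to $x_k$, and $(y,x_{-i})$ is the vector $x$ with its $i$-th entry replaced by $y$. *)

(* Defs.v *)
From HB Require Import structures.
From mathcomp Require Import all_boot all_order all_algebra.
From mathcomp Require Import all_classical all_reals all_analysis.

Set Implicit Arguments.
Unset Strict Implicit.
Unset Printing Implicit Defensive.

Import Order.TTheory GRing.Theory Num.Theory.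
Import numFieldNormedType.Exports.

Local Open Scope classical_set_scope.
Local Open Scope ring_scope.

Section Generic.
Variables (R : realType) (N : nat).
Implicit Types (x : 'cV[R]_N) (i k : 'I_N).

(* The library norm on matrices is the sup norm. *)
Definition enorm x : R := Num.sqrt (\sum_i x i 0 ^+ 2).

(* The vector (t, x_{-i}); the vector x_{-i} itself is row' i x. *)
Definition upd x i (t : R) : 'cV[R]_N := \col_j (if j == i then t else x j 0).

Definition partial k (f : 'cV[R]_N -> R) x : R := 'D_(delta_mx k 0) f x.

(* The integral of f from 0 to t, for t of either sign. *)
Definition int0 (f : R -> R) (t : R) : R :=
  if 0 <= t then \int[lebesgue_measure]_(y in `[0, t]) f y
  else - \int[lebesgue_measure]_(y in `[t, 0]) f y.

Definition argmin (f : R -> R) : set R := [set t | forall s, f t <= f s].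

(* u_i = argmin J_i(., u_{-i}) is an equality with the set of all minimizers,
   so that u_i is the unique best response to u_{-i}. *)
Definition nash_equilibrium (J : 'I_N -> 'cV[R]_N -> R) (u : 'cV[R]_N) :=
  forall i, argmin (fun t => J i (upd u i t)) = [set u i 0].

End Generic.

Section Oligopoly.
Variables (R : realType) (N : nat).
Variables (r : 'I_N -> R) (Sd : R) (m : 'I_N -> R).
Implicit Types (x : 'cV[R]_N) (i : 'I_N).

Definition Rpar : R := (\sum_k (r k)^-1)^-1.

Definition Rbar i : R := (\sum_(k | k != i) (r k)^-1)^-1.

Definition sales i x : R :=
  Rpar / r i * (Sd - x i 0 / Rbar i + \sum_(j | j != i) x j 0 / r j).

Definition cost i x : R := - sales i x * (x i 0 - m i).

Definition Qmat i : 'M[R]_N :=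
  \matrix_(j, k)
    if (j == i) && (k == i) then 2 * Rpar / (r i * Rbar i)
    else if (j != k) && ((j == i) || (k == i)) then - (Rpar / (r j * r k))
    else 0.

Definition bvec i : 'cV[R]_N :=
  \col_k
    if k == i then - (m i * Rpar / (r i * Rbar i)) - Sd * Rpar / r i
    else m i * Rpar / (r i * r k).

Definition calQ : 'M[R]_N := \matrix_(i < N) row i (Qmat i).

Definition calB : 'cV[R]_N := \col_i bvec i i 0.

(* The deceptive players are z 0, ..., z (n - 1) for an injective z; the
   coefficient of player z l is the l-th entry of delta. Only the values of D
   at deceptive players are used. *)
Variables (n : nat) (z : 'I_n -> 'I_N) (D : 'I_N -> {set 'I_N}).
Variable delta : 'cV[R]_n.

Definition deceivers i : {set 'I_N} := [set z l | l : 'I_n & i \in D (z l)].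

Definition Qbar : 'M[R]_N :=
  \matrix_(i < N)
    (row i calQ
     + \sum_(l < n | z l \in deceivers i) delta l 0 *: row (z l) (Qmat i)).

Definition Bbar : 'cV[R]_N :=
  \col_i
    (calB i 0
     + \sum_(l < n | z l \in deceivers i)
         delta l 0 * (m i * Rpar / (r i * r (z l)))).

Definition deceptive_game (Jt : 'I_N -> 'cV[R]_N -> R) : Prop :=
  forall i,
    (deceivers i != finset.set0 ->
       exists sigma : 'cV[R]_N.-1 -> R, forall x : 'cV[R]_N,
         Jt i x =
           cost i x + sigma (row' i x)
           + \sum_(l < n | z l \in deceivers i)
               delta l 0
               * int0 (fun y => partial (z l) (cost i) (upd x i y)) (x i 0))
    /\ (deceivers i = finset.set0 -> Jt i = cost i).

End Oligopoly.

(* Main.v *)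
(** Along the i-th coordinate each deceptive cost is a quadratic polynomial
    A t^2 + B t + K. With c_k = R_par / (r_i r_k), its leading coefficient is
    A = sum_(k != i) c_k - 1/2 sum_(k in K_i) delta_k c_k, which is positive
    because |delta_k| <= |delta| < 2. Hence the unique best response is the
    solution of the first-order condition 2 A t + B = 0, and these conditions
    for all i are the rows of the linear system Qbar u + Bbar = 0. *)
Require Import Defs.
From HB Require Import structures.
From mathcomp Require Import all_boot all_order all_algebra.
From mathcomp Require Import all_classical all_reals all_analysis.
From mathcomp Require Import ring lra.
Import Order.TTheory GRing.Theory Num.Theory.
Import numFieldNormedType.Exports.
Local Open Scope ring_scope.

(** * One-variable calculus *)

Lemma argmin_quadratic (R : realType) (a b c t0 : R) (f : R -> R) :
  0 < a -> (forall t, f t = a * t ^+ 2 + b * t + c) -> 2 * a * t0 + b = 0 ->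
  argmin f = [set t0]%classic.
Proof.
move=> a0 fE foc.
(* The first-order condition eliminates [b] and completes the square around [t0]. *)
have fB t : f t = f t0 + a * (t - t0) ^+ 2.
  by rewrite !fE (_ : b = - (2 * a * t0)); [ring | lra].
apply/seteqP; split => [t /(_ t0)|_ -> s] /=; last first.
  by rewrite (fB s) lerDl mulr_ge0 ?sqr_ge0 // ltW.
rewrite (fB t) gerDl pmulr_rle0 // => t_le.
by apply/eqP; rewrite -subr_eq0 -sqrf_eq0 eq_le t_le sqr_ge0.
Qed.

Lemma Rintegral_affine (R : realType) (a b s t : R) : s <= t ->
  \int[lebesgue_measure]_(y in `[s, t]%classic) (a * y + b)
  = (a / 2 * t ^+ 2 + b * t) - (a / 2 * s ^+ 2 + b * s).
Proof.
(* The fundamental theorem of calculus is applied for [s < t] only; a one-point interval has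
   integral zero. *)
rewrite le_eqVlt => /predU1P[<-|st]; first by rewrite set_itv1 Rintegral_set1 subrr.
pose F (y : R) := a / 2 * y ^+ 2 + b * y.
have dF (y : R) : is_derive y 1 F (a * y + b).
  rewrite /F; apply: is_derive_eq.
  by rewrite /GRing.scale /=; field.
have cf : continuous (fun y : R => a * y + b).
  by move=> y; apply: cvgD; [apply: cvgM; [exact: cvg_cst|exact: cvg_id]|exact: cvg_cst].
have cF : continuous F.
  by move=> y; apply/differentiable_continuous/derivable1_diffP; exact: (ex_derive (is_derive := dF y)).
rewrite /Rintegral (@continuous_FTC2 _ _ F _ _ st) //.
- exact: continuous_subspaceT.
- split=> [y _||]; first exact: (ex_derive (is_derive := dF y)).
  + exact/cvg_at_right_filter/cF.
  + exact/cvg_at_left_filter/cF.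
- by move=> y _; rewrite derive1E (derive_val (is_derive := dF y)).
Qed.

Lemma int0_affine (R : realType) (a b t : R) :
  int0 (fun y => a * y + b) t = a / 2 * t ^+ 2 + b * t.
Proof.
rewrite /int0; case: ifPn => [t0|]; first by rewrite Rintegral_affine //; ring.
by rewrite -ltNge => /ltW t0; rewrite Rintegral_affine //; ring.
Qed.

(** Since [f] is affine along the line through [a], the difference quotient equals [c] at every
    nonzero [h], hence on a punctured neighbourhood of 0. *)
Lemma derive_line (R : realType) (V W : normedModType R) (f : V -> W)
    (a v : V) (c : W) :
  (forall h : R, f (h *: v + a) = f a + h *: c) -> 'D_v f a = c.
Proof.
move=> fE; apply/cvg_lim => //.
apply: (@cvg_trans _ ((cst c : R -> W) @ 0^')%classic); last exact: cvg_cst.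
apply: near_eq_cvg; near=> h.
have h0 : h != 0 by near: h; exact: nbhs_dnbhs_neq.
by rewrite /= fE addrC addKr scalerA mulVf // scale1r.
Unshelve. all: by end_near. Qed.

Lemma abs_le_enorm (R : realType) (n : nat) (x : 'cV[R]_n) l :
  `|x l 0| <= enorm x.
Proof.
rewrite -sqrtr_sqr ler_wsqrtr // (bigD1 l) //= lerDl.
by rewrite sumr_ge0 // => k _; rewrite sqr_ge0.
Qed.

(** * Costs and matrix rows seen from one coordinate *)

Lemma updE (R : realType) (N : nat) (x : 'cV[R]_N) i t : upd x i t i 0 = t.
Proof. by rewrite mxE eqxx. Qed.

Lemma upd_neq (R : realType) (N : nat) (x : 'cV[R]_N) i j t :
  j != i -> upd x i t j 0 = x j 0.
Proof. by rewrite mxE => /negbTE ->. Qed.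

Lemma upd_upd (R : realType) (N : nat) (x : 'cV[R]_N) i s t :
  upd (upd x i s) i t = upd x i t.
Proof. by apply/colP => j; rewrite !mxE; case: (j == i). Qed.

Lemma row'_upd (R : realType) (N : nat) (x : 'cV[R]_N) i t :
  row' i (upd x i t) = row' i x.
Proof. by apply/colP => j; rewrite !mxE eq_sym (negbTE (neq_lift i j)). Qed.

Lemma cost_upd (R : realType) (N : nat) (r : 'I_N -> R) (Sd : R) (m : 'I_N -> R)
    i (x : 'cV[R]_N) t :
  cost r Sd m i (upd x i t)
  = - (Rpar r / r i * (Sd - t / Rbar r i + \sum_(j | j != i) x j 0 / r j))
    * (t - m i).
Proof.
rewrite /cost /sales updE; congr (- (_ * (_ + _)) * _).
by apply: eq_bigr => j ji; rewrite upd_neq.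
Qed.

(** For [k != i] the margin [x i 0 - m i] does not involve [x k 0], and sales are affine in it, so
    [derive_line] applies. *)
Lemma partial_cost (R : realType) (N : nat) (r : 'I_N -> R) (Sd : R)
    (m : 'I_N -> R) i k (x : 'cV[R]_N) : k != i ->
  partial k (cost r Sd m i) x = - (Rpar r / (r i * r k)) * (x i 0 - m i).
Proof.
move=> ki; apply: derive_line => h.
rewrite /cost /sales !mxE eq_sym (negbTE ki) /= mulr0 add0r.
have -> : \sum_(j | j != i) (h *: delta_mx k 0 + x) j 0 / r j
          = h / r k + \sum_(j | j != i) x j 0 / r j.
  under eq_bigr do rewrite !mxE andbT mulrDl.
  rewrite big_split /= (bigD1 k) //= eqxx mulr1 big1 ?addr0 // => j /andP[_ jk].
  by rewrite (negbTE jk) mulr0 mul0r.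
by rewrite invfM /GRing.scale /=; ring.
Qed.

Lemma Qmat_diag (R : realType) (N : nat) (r : 'I_N -> R) i (u : 'cV[R]_N) :
  \sum_j Qmat r i i j * u j 0
  = 2 * (Rpar r / (r i * Rbar r i)) * u i 0
    - Rpar r / r i * \sum_(j | j != i) u j 0 / r j.
Proof.
rewrite (bigD1 i) //= !mxE eqxx /= mulrA mulr_sumr -sumrN; congr (_ + _).
apply: eq_bigr => j ji.
by rewrite mxE eqxx [i == j]eq_sym (negbTE ji) /= invfM; ring.
Qed.

(** Away from row [i], the only nonzero entry of a row of [Qmat r i] lies in column [i]. *)
Lemma Qmat_offdiag (R : realType) (N : nat) (r : 'I_N -> R) i k (u : 'cV[R]_N) :
  k != i -> \sum_j Qmat r i k j * u j 0 = - (Rpar r / (r i * r k)) * u i 0.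
Proof.
move=> ki; rewrite (bigD1 i) //= !mxE eqxx (negbTE ki) /= big1 => [|j ji].
  by rewrite addr0 [r k * _]mulrC.
by rewrite mxE (negbTE ki) (negbTE ji) /= andbF mul0r.
Qed.

(** The single number through which deception affects player [i]: it lowers the [i]-th diagonal
    entry of [Qbar] by this amount, and the leading coefficient of the deceptive cost by half of
    it. *)
Definition deception_weight {R : realType} {N n : nat} (r : 'I_N -> R)
    (z : 'I_n -> 'I_N) (D : 'I_N -> {set 'I_N}) (delta : 'cV[R]_n) i : R :=
  \sum_(l < n | z l \in deceivers z D i)
    delta l 0 * (Rpar r / (r i * r (z l))).

Section Oligopoly.
Context {R : realType} {N : nat} {r : 'I_N -> R} {Sd : R} {m : 'I_N -> R}.
Context {n : nat} {z : 'I_n -> 'I_N} {D : 'I_N -> {set 'I_N}} {delta : 'cV[R]_n}.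
Hypothesis D_irr : forall l, z l \notin D (z l).

Let C := deception_weight r z D delta.

(** Nobody deceives itself, so [partial_cost] and [Qmat_offdiag] apply to every deceiver of [i]. *)
Lemma deceiver_neq i l : z l \in deceivers z D i -> z l != i.
Proof.
case/imsetP => l' il ->; apply: contraTneq il => zi.
by rewrite inE -zi D_irr.
Qed.

Lemma Qbar_mulmx i (u : 'cV[R]_N) :
  (Qbar r z D delta *m u) i 0
  = \sum_j Qmat r i i j * u j 0
    + \sum_(l < n | z l \in deceivers z D i)
        delta l 0 * (\sum_j Qmat r i (z l) j * u j 0).
Proof.
have QbarE j : Qbar r z D delta i j = Qmat r i i j
    + \sum_(l < n | z l \in deceivers z D i) delta l 0 * Qmat r i (z l) j.
  rewrite !mxE summxE; congr (_ + _).
  by apply: eq_bigr => l _; rewrite !mxE.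
rewrite mxE; under eq_bigr do rewrite QbarE mulrDl mulr_suml.
rewrite big_split exchange_big /=; congr (_ + _).
by apply: eq_bigr => l _; rewrite mulr_sumr; apply: eq_bigr => j _; rewrite mulrA.
Qed.

(** This is row [i] of the linear system, arranged as the derivative at [u i 0] of the quadratic
    that [deceptive_cost_upd] yields. *)
Lemma first_order_condition i (u : 'cV[R]_N) :
  Qbar r z D delta *m u + Bbar r Sd m z D delta = 0 ->
  (2 * (Rpar r / (r i * Rbar r i)) - C i) * u i 0
  - Rpar r / r i * (Sd + \sum_(j | j != i) u j 0 / r j)
  - m i * (Rpar r / (r i * Rbar r i)) + m i * C i = 0.
Proof.
move=> /colP /(_ i); rewrite mxE Qbar_mulmx !mxE eqxx => eq0.
rewrite -[RHS]eq0 {eq0} Qmat_diag.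
have -> : \sum_(l < n | z l \in deceivers z D i)
            delta l 0 * (\sum_j Qmat r i (z l) j * u j 0) = - C i * u i 0.
  rewrite -sumrN mulr_suml; apply: eq_bigr => l /deceiver_neq zl.
  by rewrite Qmat_offdiag //; ring.
have -> : \sum_(l < n | z l \in deceivers z D i)
            delta l 0 * (m i * Rpar r / (r i * r (z l))) = m i * C i.
  by rewrite mulr_sumr; apply: eq_bigr => l _; ring.
by ring.
Qed.

(** The [sigma] term is constant along coordinate [i] and becomes [K]; each deceiver contributes the
    integral of the affine function [- c * (y - m i)]. *)
Lemma deceptive_cost_upd (Jt : 'I_N -> 'cV[R]_N -> R) i (u : 'cV[R]_N) :
  deceptive_game r Sd m z D delta Jt ->
  exists K : R, forall t, Jt i (upd u i t)
    = cost r Sd m i (upd u i t) + K - C i * (t ^+ 2 / 2 - m i * t).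
Proof.
move=> /(_ i) [Jt_def Jt_eq].
have [Ki0|/Jt_def [sigma JtE]] := eqVneq (deceivers z D i) finset.set0.
  exists 0 => t; rewrite Jt_eq // /C /deception_weight big_pred0 => [|l].
    by rewrite mul0r addr0 subr0.
  by rewrite Ki0 inE.
exists (sigma (row' i u)) => t; rewrite JtE row'_upd -mulNr -sumrN mulr_suml.
congr (_ + _); apply: eq_bigr => l /deceiver_neq zl.
set c := Rpar r / (r i * r (z l)).
rewrite (_ : (fun y => _) = (fun y => - c * y + c * m i)).
  by rewrite int0_affine updE; ring.
by apply/funext => y; rewrite partial_cost // updE -/c; ring.
Qed.

(** * Positivity of the leading coefficient *)

Hypothesis r_gt0 : forall i, 0 < r i.
Hypothesis z_inj : injective z.
Hypothesis delta_lt2 : enorm delta < 2.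
Hypothesis N_ge2 : (2 <= N)%N.

Lemma Rpar_gt0 : 0 < Rpar r.
Proof.
rewrite invr_gt0 (bigD1 (Ordinal (ltnW N_ge2))) //= ltr_pwDl ?invr_gt0 //.
by rewrite sumr_ge0 // => k _; rewrite invr_ge0 ltW.
Qed.

(** Twice the sum of [c] over the deceivers lies between the two sides. The left comparison is
    strict if there is a deceiver; otherwise [C i] is zero and the right side is positive, as
    [2 <= N] provides a competitor. *)
Lemma deception_weight_lt i : C i < 2 * (Rpar r / (r i * Rbar r i)).
Proof.
pose c k := Rpar r / (r i * r k).
have c_gt0 k : 0 < c k by rewrite divr_gt0 ?mulr_gt0 ?Rpar_gt0.
have -> : Rpar r / (r i * Rbar r i) = \sum_(k | k != i) c k.
  rewrite /Rbar invfM invrK mulrA mulr_sumr; apply: eq_bigr => k _.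
  by rewrite /c invfM mulrA.
have cK_le : \sum_(l < n | z l \in deceivers z D i) c (z l)
             <= \sum_(k | k != i) c k.
  (* Injectivity of [z] means that no player is counted twice, so this is a subsum of positive
     terms. *)
  rewrite -big_set /= -(big_imset c) /=; last by move=> l l' _ _; exact: z_inj.
  rewrite [leLHS]big_mkcond [leRHS]big_mkcond /=; apply: ler_sum => k _.
  case: ifPn => [/imsetP[l + ->]|_]; last by case: ifP => // _; rewrite ltW.
  by rewrite inE => /deceiver_neq ->.
have [l zl|K0] := pickP (fun l => z l \in deceivers z D i).
  apply: (@lt_le_trans _ _ (2 * \sum_(l < n | z l \in deceivers z D i) c (z l))).
    rewrite mulr_sumr; apply: ltr_sum => [|l' _].
      by apply/hasP; exists l => //; rewrite mem_index_enum.
    rewrite (ltr_pM2r (c_gt0 _)) (le_lt_trans (ler_norm _)) //.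
    exact: le_lt_trans (abs_le_enorm _ _ _ _) delta_lt2.
  by rewrite ler_pM2l.
rewrite /C /deception_weight big_pred0 // mulr_gt0 //.
have [j ji] : exists j, j != i.
  have /card_gt1P[j [k [_ _ jk]]] : (1 < #|'I_N|)%N by rewrite card_ord.
  by have [ji|ji] := eqVneq j i; [exists k; rewrite -ji eq_sym | exists j].
rewrite (bigD1 j) //= ltr_pwDl //.
by rewrite sumr_ge0 // => k _; rewrite ltW.
Qed.

End Oligopoly.

Theorem theorem2 (R : realType) (N : nat) (N_ge2 : (2 <= N)%N)
    (r : 'I_N -> R) (r_gt0 : forall i, 0 < r i) (Sd : R) (m : 'I_N -> R)
    (n : nat) (z : 'I_n -> 'I_N) (z_inj : injective z)
    (D : 'I_N -> {set 'I_N})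
    (D_neq0 : forall l, D (z l) != finset.set0)
    (D_irr : forall l, z l \notin D (z l))
    (delta : 'cV[R]_n) (delta_gt0 : 0 < enorm delta)
    (delta_lt2 : enorm delta < 2)
    (Qbar_unit : Qbar r z D delta \in unitmx)
    (Jt : 'I_N -> 'cV[R]_N -> R)
    (Jt_game : deceptive_game r Sd m z D delta Jt) :
  nash_equilibrium Jt
    (- (invmx (Qbar r z D delta) *m Bbar r Sd m z D delta)).
Proof.
set u := - _ => i.
have Qu : Qbar r z D delta *m u + Bbar r Sd m z D delta = 0.
  by rewrite mulmxN mulmxA mulmxV // mul1mx addNr.
have foc := first_order_condition D_irr i _ Qu.
have [K JtE] := deceptive_cost_upd D_irr _ i u Jt_game.
have C_lt := deception_weight_lt D_irr r_gt0 z_inj delta_lt2 N_ge2 i.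
move: foc JtE C_lt.
set C := deception_weight _ _ _ _ _; set a := Rpar r / (r i * Rbar r i).
set p := Rpar r / r i; set S := \sum_(j | j != i) _ => foc JtE C_lt.
(* The coefficients come from expanding [- (p * (Sd - t / Rbar r i + S)) * (t - m i) + K - C * (t ^+
   2 / 2 - m i * t)] in [t]. *)
apply: (@argmin_quadratic _ (a - C / 2)
          (m i * C - m i * a - p * (Sd + S)) (p * (Sd + S) * m i + K)).
- lra.
- move=> t; rewrite JtE cost_upd -/p -/S.
  have -> : a = p / Rbar r i by rewrite /a invfM mulrA.
  (* Naming the inverse makes it an atom, so [field] does not ask for [Rbar r i] to be nonzero. *)
  by set q := (Rbar r i)^-1; field.
- by rewrite -[RHS]foc; field.
Qed.
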